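(* Let $\tau$ be a signature, let $\mathbb{H}$ be a finite $\tau$-structure with universe $H$, and let $J\subseteq H$. Then the following are equivalent: (A1) $\mathbb{H}$ dismantles to a substructure $\mathbb{I}$ whose universe contains $J$ and such that $\mathbb{I}^2$ dismantles to its diagonal; (A2) $\mathbb{H}^2$ dismantles to a substructure $\mathbb{K}$ whose universe $K$ satisfies $\Delta(J^2)\subseteq K\subseteq \Delta(H^2)$; (B1) $C(\mathbb{G},\mathbb{H})$ is $J$-connected for every locally finite $\tau$-structure $\mathbb{G}$; (B2) there exists $n\ge1$ such that $C_n(\mathbb{G},\mathbb{H})$ is $J$-connected for every finite $\tau$-structure $\mathbb{G}$; (B3) $C(\mathbb{L}\times\mathbb{H}^2,\mathbb{H})$ is $J$-connected; (B4) $L(\mathbb{G},\mathbb{H})$ is $J$-connected for every finite $\tau$-structure $\mathbb{G}$; (B5) the projections $\pi_1$ and $\pi_2$ are joined by a $J$-preserving walk in $L(\mathbb{H}^2,\mathbb{H})$; (C1) there exists $g\ge0$ such that $\mathrm{Hom}(\mathbb{G},\mathbb{H})$ is strongly $J$-irreducible with gap $g$ for every $\tau$-structure $\mathbb{G}$; (C2) there exists $g\ge0$ such that $\mathrm{Hom}(\mathbb{T}_{\mathbb{H}^2},\mathbb{H})$ is $(\{x\},W)$-mixing with respect to $J$ for all $x\in T_{\mathbb{H}^2}$ and $W\subseteq T_{\mathbb{H}^2}$ with $\mathrm{dist}(x,W)\ge g$.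
   Context: A signature $\tau$ is a set of relation symbols, each with an arity $k\ge1$. A $\tau$-structure $\mathbb{H}$ consists of a countable set $H$ (its universe) and, for each $k$-ary $R\in\tau$, a relation $R(\mathbb{H})\subseteq H^k$. Maps are applied to tuples componentwise. A homomorphism $\mathbb{G}\to\mathbb{H}$ is a map $\phi:G\to H$ with $\phi(\mathbf{a})\in R(\mathbb{H})$ for all $R\in\tau$, $\mathbf{a}\in R(\mathbb{G})$; $\mathrm{Hom}(\mathbb{G},\mathbb{H})$ is the set of these. $\mathbb{J}$ is a substructure of $\mathbb{H}$ if $J\subseteq H$ and $R(\mathbb{J})\subseteq R(\mathbb{H})$; it is induced by $J$ if $R(\mathbb{J})=R(\mathbb{H})\cap J^k$ for each $k$-ary $R$. Domination: $b$ dominates $a$ in $\mathbb{H}$ if for every $k$-ary $R$, every $i$ and every $(a_1,\dots,a_k)\in R(\mathbb{H})$ with $a_i=a$, also $(a_1,\dots,a_{i-1},b,a_{i+1},\dots,a_k)\in R(\mathbb{H})$. A sequence $\mathbb{J}_0,\dots,\mathbb{J}_\ell$ ($\ell\ge0$) is a dismantling sequence if for each $j<\ell$ there are $a_j\neq b_j$ in $J_j$ with $b_j$ dominating $a_j$ in $\mathbb{J}_j$ and $\mathbb{J}_{j+1}$ the substructure induced by $J_j\setminus\{a_j\}$; then $\mathbb{J}_0$ dismantles to $\mathbb{J}_\ell$. Product $\mathbb{H}_1\times\mathbb{H}_2$: universe $H_1\times H_2$, $R$ consists of the tuples $((a_1,b_1),\dots,(a_k,b_k))$ with $(a_i)\in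 R(\mathbb{H}_1)$, $(b_i)\in R(\mathbb{H}_2)$; $\mathbb{H}^2=\mathbb{H}\times\mathbb{H}$ with projections $\pi_1(a,b)=a,\pi_2(a,b)=b$. $\Delta(H^2)=\{(a,a):a\in H\}$, $\Delta(J^2)=\{(a,a):a\in J\}$, and the diagonal of $\mathbb{I}^2$ is the substructure induced by $\Delta(I^2)$. Walks: a walk in $\mathbb{H}$ is a sequence $a_0,i_1,(R_1,\mathbf{a}_1),j_1,a_1,\dots,i_n,(R_n,\mathbf{a}_n),j_n,a_n$ ($n\ge0$ its length) with $\mathbf{a}_\ell\in R_\ell(\mathbb{H})$, $i_\ell\neq j_\ell$, $a_{\ell-1}$ the $i_\ell$-th and $a_\ell$ the $j_\ell$-th entry of $\mathbf{a}_\ell$; it joins $a_0$ and $a_n$ (ending point). $\mathrm{dist}(a,b)$ = minimal length of a joining walk ($\infty$ if none), $\mathrm{dist}(V,W)=\min_{a\in V,b\in W}\mathrm{dist}(a,b)$. $\mathbb{G}$ is locally finite if each element occurs in finitely many tuples. Forest of walks $\mathbb{T}_{\mathbb{H}}$: universe $T_{\mathbb{H}}$ = all walks in $\mathbb{H}$; for $k$-ary $R$, every $\mathbf{a}=(a_1,\dots,a_k)\in R(\mathbb{H})$, every $i$ and every walk $w$ ending at $a_i$, $(w_1,\dots,w_{i-1},w,w_{i+1},\dots,w_k)\in R(\mathbb{T}_{\mathbb{H}})$, where $w_j$ ($j\ne i$) is $w$ extended by $i,(R,\mathbf{a}),j,a_j$; no other tuples. Graphs of homomorphisms: $C_n(\mathbb{G},\mathbb{H})$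 has vertices $\mathrm{Hom}(\mathbb{G},\mathbb{H})$, $\phi\sim\psi$ iff they differ on at most $n$ elements; $C=C_1$. The 1-link $\mathbb{L}$ has universe $\{0,1\}$ and $R(\mathbb{L})=\{0,1\}^k$ for each $k$-ary $R$. $L(\mathbb{G},\mathbb{H})$ has vertices $\mathrm{Hom}(\mathbb{G},\mathbb{H})$, $\phi\sim\psi$ iff for each $k$-ary $R$ and $(x_1,\dots,x_k)\in R(\mathbb{G})$, $(\gamma_1(x_1),\dots,\gamma_k(x_k))\in R(\mathbb{H})$ for all $\gamma_i\in\{\phi,\psi\}$. A sequence $\phi_1,\dots,\phi_t$ of homomorphisms $\mathbb{G}\to\mathbb{H}$ is $J$-preserving if for every $x\in G$ with $\phi_1(x)=\phi_t(x)=a\in J$ we have $\phi_i(x)=a$ for all $i$. A graph of homomorphisms is $J$-connected if any two homomorphisms agreeing on all but finitely many elements of $G$ are joined by a $J$-preserving walk (sequence of successively adjacent vertices). Mixing: $\mathrm{Hom}(\mathbb{G},\mathbb{H})$ is $(V,W)$-mixing with respect to $J$ if for all $\phi,\psi\in\mathrm{Hom}(\mathbb{G},\mathbb{H})$ there is $\gamma\in\mathrm{Hom}(\mathbb{G},\mathbb{H})$ agreeing with $\phi$ on $V$, with $\psi$ on $W$, and with $\gamma(x)=\phi(x)=\psi(x)$ for every $x$ with $\phi(x)=\psi(x)\in J$. It is strongly $J$-irreducible with gap $g$ if it is $(V,W)$-mixing with respect to $J$ for all $V,W\subseteq G$ with $\mathrm{dist}(V,W)\ge g$. *)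

(* Defs.v *)
From mathcomp Require Import all_boot.
From mathcomp Require Import boolp classical_sets functions cardinality.

Set Implicit Arguments.
Unset Strict Implicit.
Unset Printing Implicit Defensive.

Local Open Scope classical_set_scope.
Local Open Scope card_scope.

Record signature := Signature {
  symbol :> Type;
  arity : symbol -> nat;
  arity_gt0 : forall R : symbol, 0 < arity R }.

(* Countability of the universe is not a field but the separate predicate
   [countable_str]: over an uncountable signature the forest of walks may have
   an uncountable universe, and it is to be available for every signature. *)
Record structure (tau : signature) := Structure {
  universe :> Type;
  rel_of : forall R : tau, set ('I_(arity R) -> universe) }.

Arguments rel_of {tau} s R _.

Section Structures.
Variable tau : signature.
Implicit Types (G H : structure tau).

Definition countable_str H : Prop := countable [set: H].

Definition finite_str H : Prop := finite_set [set: H].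

(* A tuple is counted together with the relation it belongs to. *)
Definition locally_finite H : Prop :=
  forall x : H,
    finite_set [set p : {R : tau & 'I_(arity R) -> H} |
                 rel_of H (tag p) (tagged p) /\ exists i, tagged p i = x].

Definition Hom G H : set (G -> H) :=
  [set phi : G -> H | forall (R : tau) (a : 'I_(arity R) -> G),
               rel_of G R a -> rel_of H R (phi \o a)].

Arguments Hom : clear implicits.

Definition induced H (S : set H) : structure tau :=
  @Structure tau {x : H | S x}
    (fun R => [set a | rel_of H R (fun i => sval (a i))]).

Arguments induced : clear implicits.

Definition prod_str G H : structure tau :=
  @Structure tau (G * H)%type
    (fun R => [set a | rel_of G R (fst \o a) /\ rel_of H R (snd \o a)]).

Definition square H : structure tau := prod_str H H.

Definition one_link : structure tau :=
  @Structure tau bool (fun R => [set: 'I_(arity R) -> bool]).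

Definition dominates H (b a : H) : Prop :=
  forall (R : tau) (i : 'I_(arity R)) (t : 'I_(arity R) -> H),
    rel_of H R t -> t i = a -> rel_of H R [eta t with i |-> b].

Arguments dominates : clear implicits.

(* All members of a dismantling sequence starting at [H] are induced
   substructures of [H], so they are given by their universes. *)
Definition dismantling_seq H (l : nat) (S : nat -> set H) : Prop :=
  S 0 = [set: H] /\
  forall j, j < l ->
    exists a b : induced H (S j),
      [/\ a <> b, dominates (induced H (S j)) b a & S j.+1 = S j `\ sval a].

Arguments dismantling_seq : clear implicits.

Definition dismantles_to H (I : set H) : Prop :=
  exists (l : nat) (S : nat -> set H), dismantling_seq H l S /\ S l = I.

(* The walk [a_0, i_1, (R_1, t_1), j_1, a_1, ...] is built from its first
   element by extensions at the end; the elements [a_1, a_2, ...] are not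
   stored, as [a_l] is the [j_l]-th entry of [t_l]. *)
Inductive pre_walk H : Type :=
| Start of H
| Extend (w : pre_walk H) (R : tau) (t : 'I_(arity R) -> H)
    (i j : 'I_(arity R)).

Fixpoint walk_start H (w : pre_walk H) : H :=
  match w with Start a => a | Extend w' _ _ _ _ => walk_start w' end.

Definition walk_end H (w : pre_walk H) : H :=
  match w with Start a => a | Extend _ _ t _ j => t j end.

Fixpoint walk_length H (w : pre_walk H) : nat :=
  match w with Start _ => 0 | Extend w' _ _ _ _ => (walk_length w').+1 end.

Fixpoint is_walk H (w : pre_walk H) : Prop :=
  match w with
  | Start _ => True
  | Extend w' R t i j =>
      [/\ is_walk w', rel_of H R t, i <> j & t i = walk_end w']
  end.

(* [dist_ge V W g] is [dist(V, W) >= g]; the minimum of no lengths is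
   infinity. *)
Definition dist_ge H (V W : set H) (g : nat) : Prop :=
  forall w : pre_walk H,
    is_walk w -> V (walk_start w) -> W (walk_end w) -> g <= walk_length w.

Definition walk_forest H : structure tau :=
  @Structure tau {w : pre_walk H | is_walk w}
    (fun R => [set u | exists (t : 'I_(arity R) -> H) (i : 'I_(arity R)),
       [/\ rel_of H R t,
           walk_end (sval (u i)) = t i &
           forall j, j <> i -> sval (u j) = Extend (sval (u i)) t i j]]).

(* Adjacency in the graphs [C_n(G, H)] and [L(G, H)], whose vertices are the
   elements of [Hom G H]. *)
Definition C_adj (n : nat) G H (phi psi : G -> H) : Prop :=
  [set x | phi x <> psi x] #<= `I_n.

Definition L_adj G H (phi psi : G -> H) : Prop :=
  forall (R : tau) (x : 'I_(arity R) -> G), rel_of G R x ->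
  forall gamma : 'I_(arity R) -> G -> H,
    (forall i, gamma i = phi \/ gamma i = psi) ->
    rel_of H R (fun i => gamma i (x i)).

(* The sequence is [f 0, ..., f t]; values of [f] beyond [t] are irrelevant. *)
Definition preserving G H (J : set H) (t : nat) (f : nat -> G -> H) : Prop :=
  forall (x : G) (a : H), J a -> f 0 x = a -> f t x = a ->
  forall i, i <= t -> f i x = a.

Definition joined G H (J : set H) (adj : (G -> H) -> (G -> H) -> Prop)
    (phi psi : G -> H) : Prop :=
  exists (t : nat) (f : nat -> G -> H),
    [/\ f 0 = phi, f t = psi,
        forall i, i <= t -> Hom G H (f i),
        forall i, i < t -> adj (f i) (f i.+1) &
        preserving J t f].

Definition connected_wrt G H (J : set H)
    (adj : (G -> H) -> (G -> H) -> Prop) : Prop :=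
  forall phi psi : G -> H, Hom G H phi -> Hom G H psi ->
    finite_set [set x | phi x <> psi x] -> joined J adj phi psi.

Definition mixing G H (J : set H) (V W : set G) : Prop :=
  forall phi psi : G -> H, Hom G H phi -> Hom G H psi ->
  exists gamma : G -> H,
    [/\ Hom G H gamma,
        forall x, V x -> gamma x = phi x,
        forall x, W x -> gamma x = psi x &
        forall x, phi x = psi x -> J (phi x) -> gamma x = phi x].

Definition strongly_irreducible G H (J : set H) (g : nat) : Prop :=
  forall V W : set G, dist_ge V W g -> mixing J V W.

End Structures.

Arguments Hom {tau} G H phi.
Arguments induced {tau} H S.
Arguments one_link tau : clear implicits.
Arguments dominates {tau} H b a.
Arguments dismantling_seq {tau} H l S.
Arguments dismantles_to {tau} H I.
Arguments C_adj {tau} n G H phi psi.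
Arguments L_adj {tau} G H phi psi.
Arguments joined {tau} G H J adj phi psi.
Arguments connected_wrt {tau} G H J adj.
Arguments dist_ge {tau} H V W g.
Arguments mixing {tau} G H J V W.
Arguments strongly_irreducible {tau} G H J g.

Definition diag (T : Type) (S : set T) : set (T * T) := [set (a, a) | a in S].

(* Main.v *)
(* A finite structure X dismantles to D exactly when the identity of X is joined
   in L(X, X), by a walk fixing D pointwise, to a map into D: a fold is a step of
   such a walk, and conversely the first map of the walk that moves some a moves
   it to an element dominating a, so that a can be folded away.

   Applied to H^2, this makes (A2) the existence of a J-preserving walk from pi_1
   to pi_2 in L(H^2, H), i.e. (B5).  Conversely, let I be obtained from H by
   folding as long as possible outside J; no element of I outside J being
   dominated, the walk stays constant on the diagonal of I^2, and dismantles I^2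
   to it, which is (A1).  Precomposing the walk with (phi, psi) gives (B4), and
   letting its time parameter depend on the capped distance to V gives (C1).
   For (B1), the retraction of H onto I is switched on around the finite set where
   phi and psi differ, the walk on I^2 is run there, and the retraction is
   switched off.  (B2) and (B3) return to (B5) by looking at the layers of
   E x H^2, where E is a complete structure.  Finally, mixing on the forest of
   walks (or, to keep the universe countable over any signature, on H^2 x nat
   with tuples varying by at most 1 in the second coordinate) forces (A1). *)

Require Import Defs.
From mathcomp Require Import all_boot.
From mathcomp Require Import boolp classical_sets functions cardinality.
From mathcomp Require Import zify.

Set Implicit Arguments.
Unset Strict Implicit.
Unset Printing Implicit Defensive.

Local Open Scope classical_set_scope.

Lemma sval_inj (T : Type) (P : T -> Prop) : injective (@sval T P).
Proof. by move=> [x Px] [y Py] /= xy; exact: eq_exist. Qed.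

(** * Walks subject to an invariant *)

(** Each vertex carries the invariant [P], so that walks can be concatenated, reversed and mapped
    without indices. *)
Inductive conn (T : Type) (adj : T -> T -> Prop) (P : set T) : T -> T -> Prop :=
| conn_refl x : P x -> conn adj P x x
| conn_step x y z : P x -> adj x y -> conn adj P y z -> conn adj P x z.

Lemma conn_start (T : Type) (adj : T -> T -> Prop) (P : set T) x y :
  conn adj P x y -> P x.
Proof. by case. Qed.

Lemma conn_end (T : Type) (adj : T -> T -> Prop) (P : set T) x y :
  conn adj P x y -> P y.
Proof. by elim. Qed.

Lemma conn_trans (T : Type) (adj : T -> T -> Prop) (P : set T) y x z :
  conn adj P x y -> conn adj P y z -> conn adj P x z.
Proof.
elim=> // {}x u v Px xu _ IH /IH; exact: conn_step.
Qed.

Lemma conn_adj (T : Type) (adj : T -> T -> Prop) (P : set T) x y :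
  P x -> P y -> adj x y -> conn adj P x y.
Proof. by move=> Px Py xy; apply: conn_step xy _ => //; exact: conn_refl. Qed.

Lemma conn_sym (T : Type) (adj : T -> T -> Prop) (P : set T) x y :
  (forall u v, adj u v -> adj v u) -> conn adj P x y -> conn adj P y x.
Proof.
move=> adjC; elim=> [{}x|{}x u v Px xu uv vu]; first exact: conn_refl.
by apply: conn_trans vu _; apply: conn_adj => //; [exact: conn_start uv|exact: adjC].
Qed.

Lemma conn_bind (T U : Type) (adj : T -> T -> Prop) (P : set T)
    (adj' : U -> U -> Prop) (P' : set U) (m : T -> U) x y :
  (forall u, P u -> P' (m u)) ->
  (forall u v, P u -> P v -> adj u v -> conn adj' P' (m u) (m v)) ->
  conn adj P x y -> conn adj' P' (m x) (m y).
Proof.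
move=> mP madj; elim=> [{}x Px|{}x u v Px xu uv]; first exact/conn_refl/mP.
by apply: conn_trans; apply: madj => //; exact: conn_start uv.
Qed.

Lemma conn_map (T U : Type) (adj : T -> T -> Prop) (P : set T)
    (adj' : U -> U -> Prop) (P' : set U) (m : T -> U) x y :
  (forall u, P u -> P' (m u)) ->
  (forall u v, P u -> P v -> adj u v -> adj' (m u) (m v)) ->
  conn adj P x y -> conn adj' P' (m x) (m y).
Proof.
move=> mP madj; apply: conn_bind => // u v Pu Pv uv.
by apply: conn_adj; [exact: mP|exact: mP|exact: madj].
Qed.

Lemma conn_invariant (T : Type) (adj : T -> T -> Prop) (P Q : set T) x y :
  (forall u v, P u -> P v -> adj u v -> Q u -> Q v) ->
  Q x -> conn adj P x y -> conn adj (P `&` Q) x y.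
Proof.
move=> PQ Qx xy; elim: xy Qx => [{}x Px Qx|{}x u v Px xu uv IH Qx].
  exact: conn_refl.
have Pu := conn_start uv.
have Qu : Q u by exact: (PQ x).
by apply: conn_step xu (IH Qu).
Qed.

Lemma conn_escape (T : Type) (adj : T -> T -> Prop) (P Q : set T) x y :
  conn adj P x y -> Q x ->
  Q y \/ exists u v, [/\ P u, P v, adj u v, Q u & ~ Q v].
Proof.
elim=> [{}x _ Qx|{}x u v Px xu uv IH Qx]; first by left.
have [/IH//|nQu] := pselect (Q u).
by right; exists x, u; split=> //; exact: conn_start uv.
Qed.

Lemma conn_seqP (T : Type) (adj : T -> T -> Prop) (P : set T) x y :
  conn adj P x y <->
  exists (t : nat) (f : nat -> T),
    [/\ f 0 = x, f t = y, forall i, i <= t -> P (f i) &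
        forall i, i < t -> adj (f i) (f i.+1)].
Proof.
split.
  elim=> [{}x Px|{}x u v Px xu _ [t [f [f0 ft fP fadj]]]].
    by exists 0, (fun=> x); split.
  exists t.+1, (fun i => if i is j.+1 then f j else x); split=> //.
    by case=> // i /fP.
  by case=> [|i]; [rewrite f0|exact: fadj].
move=> [t [f [<- <-]]]; elim: t => [|t IH] fP fadj.
  by apply: conn_refl; exact: fP.
apply: (@conn_trans _ _ _ (f t)).
  by apply: IH => i it; [apply: fP|apply: fadj]; exact: leq_trans it _.
by apply: conn_adj; [exact: fP|exact: fP|exact: fadj].
Qed.

(** Resting at the last vertex lets every natural number serve as a time. *)
Lemma conn_stationary (T : Type) (adj : T -> T -> Prop) (P : set T) x y :
  (forall u, P u -> adj u u) -> conn adj P x y ->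
  exists (t : nat) (f : nat -> T),
    [/\ f 0 = x, forall i, t <= i -> f i = y, forall i, P (f i) &
        forall i, adj (f i) (f i.+1)].
Proof.
move=> adjxx /conn_seqP[t [f [f0 ft fP fadj]]].
exists t, (fun i => f (minn i t)); split=> [|i /minn_idPr ->//|i|i].
- by rewrite min0n.
- by apply: fP; exact: geq_minr.
- have /= [it|ti] := ltnP i t.
    have -> : minn i.+1 t = i.+1 by lia.
    exact: fadj.
  have -> : minn i.+1 t = t by lia.
  exact/adjxx/fP.
Qed.

(** Preservation refers only to the two ends of a walk, so it becomes a condition on each single
    map. *)
Definition keeps (tau : signature) (G H : structure tau) (J : set H)
    (phi psi : G -> H) : set (G -> H) :=
  [set f | Hom G H f /\
           forall x, phi x = psi x -> J (phi x) -> f x = phi x].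

Lemma joinedP (tau : signature) (G H : structure tau) (J : set H)
    (adj : (G -> H) -> (G -> H) -> Prop) (phi psi : G -> H) :
  joined G H J adj phi psi <-> conn adj (keeps J phi psi) phi psi.
Proof.
rewrite conn_seqP; split=> -[t [f]].
  move=> [f0 ft fH fadj fJ]; exists t, f; split=> // i it; split; first exact: fH.
  by move=> x xE Jx; apply: fJ it => //; rewrite ?f0 ?ft.
move=> [f0 ft fP fadj]; exists t, f; split=> //.
  by move=> i /fP[].
by move=> x a Ja; rewrite f0 ft => xE yE i /fP[_ ->]; rewrite xE.

Qed.

(** * The graph L(G, H) *)

Lemma L_adjP (tau : signature) (G H : structure tau) (f g : G -> H) :
  L_adj G H f g <->
  forall (R : tau) (x : 'I_(arity R) -> G) (y : 'I_(arity R) -> H),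
    rel_of G R x -> (forall i, y i = f (x i) \/ y i = g (x i)) ->
    rel_of H R y.
Proof.
split=> fg R x.
  move=> y Rx yE.
  pose gam i := if pselect (y i = f (x i)) then f else g.
  have -> : y = fun i => gam i (x i).
    apply: funext => i; rewrite /gam.
    by case: pselect => // nf; case: (yE i).
  by apply: fg => // i; rewrite /gam; case: pselect; [left|right].
move=> Rx gam gamE; apply: (fg R x) => // i.
by case: (gamE i) => ->; [left|right].
Qed.

Lemma L_adj_refl (tau : signature) (G H : structure tau) (f : G -> H) :
  Hom G H f -> L_adj G H f f.
Proof.
move=> fH; apply/L_adjP => R x y Rx yE.
have -> : y = f \o x by apply: funext => i; case: (yE i).
exact: fH.
Qed.

Lemma L_adj_sym (tau : signature) (G H : structure tau) (f g : G -> H) :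
  L_adj G H f g -> L_adj G H g f.
Proof.
move=> /L_adjP fg; apply/L_adjP => R x y Rx yE.
by apply: fg Rx _ => i; case: (yE i); [right|left].
Qed.

Lemma L_adj_homl (tau : signature) (G H : structure tau) (f g : G -> H) :
  L_adj G H f g -> Hom G H f.
Proof. by move=> /L_adjP fg R x Rx; apply: fg Rx _ => i; left. Qed.

Lemma Hom_comp (tau : signature) (A B C : structure tau) (u : A -> B)
    (v : B -> C) :
  Hom A B u -> Hom B C v -> Hom A C (v \o u).
Proof. by move=> uH vH R x /uH /vH. Qed.

Lemma Hom_pair (tau : signature) (A B C : structure tau) (u : A -> B)
    (v : A -> C) :
  Hom A B u -> Hom A C v -> Hom A (prod_str B C) (fun x => (u x, v x)).
Proof. by move=> uH vH R x Rx; split; [exact: uH|exact: vH]. Qed.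

Lemma Hom_fst (tau : signature) (A B : structure tau) :
  Hom (prod_str A B) A fst.
Proof. by move=> R x []. Qed.

Lemma Hom_snd (tau : signature) (A B : structure tau) :
  Hom (prod_str A B) B snd.
Proof. by move=> R x []. Qed.

Lemma Hom_sval (tau : signature) (A : structure tau) (S : set A) :
  Hom (induced A S) A sval.
Proof. by []. Qed.

Lemma L_adj_comp (tau : signature) (A B C : structure tau) (f g : B -> C)
    (u : A -> B) :
  L_adj B C f g -> Hom A B u -> L_adj A C (f \o u) (g \o u).
Proof.
move=> /L_adjP fg uH; apply/L_adjP => R x y Rx yE.
exact: (fg R (u \o x)) (uH _ _ Rx) yE.
Qed.

Lemma L_adj_post (tau : signature) (A B C : structure tau) (f g : A -> B)
    (v : B -> C) :
  L_adj A B f g -> Hom B C v -> L_adj A C (v \o f) (v \o g).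
Proof.
move=> fg vH R x Rx gam gamE.
have /choice[z zE] : forall i, exists h, (h = f \/ h = g) /\ gam i = v \o h.
  by move=> i; case: (gamE i) => ->; [exists f|exists g]; split=> //; [left|right].
have -> : (fun i => gam i (x i)) = v \o (fun i => z i (x i)).
  by apply: funext => i; rewrite (zE i).2.
by apply: vH; apply: fg => // i; exact: (zE i).1.
Qed.

Lemma L_adj_pair (tau : signature) (A B C : structure tau) (u : A -> B)
    (f g : A -> C) :
  Hom A B u -> L_adj A C f g ->
  L_adj A (prod_str B C) (fun x => (u x, f x)) (fun x => (u x, g x)).
Proof.
move=> uH /L_adjP fg; apply/L_adjP => R x y Rx yE; split.
  have -> : fst \o y = u \o x by apply: funext => i /=; case: (yE i) => ->.
  exact: uH.
by apply: fg Rx _ => i /=; case: (yE i) => ->; [left|right].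
Qed.

(* A time function that is 1-Lipschitz on tuples can only mix two successive
   members of an L-walk inside a tuple. *)
Lemma rel_time_mix (tau : signature) (G H : structure tau) (h : nat -> G -> H)
    (hadj : forall i, L_adj G H (h i) (h i.+1)) (R : tau)
    (x : 'I_(arity R) -> G) (c : 'I_(arity R) -> nat) :
  rel_of G R x -> (forall i j, c i <= (c j).+1) ->
  rel_of H R (fun i => h (c i) (x i)).
Proof.
move=> Rx cLip.
case: (@arg_minnP _ (Ordinal (arity_gt0 R)) xpredT c isT) => i0 _ ci0.
move/L_adjP: (hadj (c i0)) => /(_ R x _ Rx); apply=> i.
have : c i = c i0 \/ c i = (c i0).+1.
  by have := cLip i i0; have := ci0 i isT; lia.
by case=> ->; [left|right].
Qed.

(** * Finite universes *)

Lemma finite_codeP (T : Type) :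
  finite_set [set: T] <-> exists (F : finType) (f : T -> F), injective f.
Proof.
split=> [[n]|[F [f finj]]].
  move=> /card_eq_trans/(_ (@card_II n))/card_bijP[f /bij_inj finj].
  pose inT (x : T) : [set: T] := SigSub (in_setT x).
  exists 'I_n, (fun x => val (f (inT x))) => x y /val_inj/finj xy.
  exact: (congr1 val xy).
rewrite -(preimage_setT f); apply: finite_preimage; last exact: finite_finset.
by move=> x y _ _; exact: finj.
Qed.

Lemma finite_wf (T : Type) (P : set T -> Prop) :
  finite_set [set: T] ->
  (forall S, (forall S', S' `<` S -> P S') -> P S) -> forall S, P S.
Proof.
move=> /finite_codeP[F [f finj]] step S.
pose img (A : set T) := [set u : F | `[< exists2 x, A x & f x = u >]]%SET.
have [n] := ubnP #|img S|; elim: n S => // n IH S Sn.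
apply: step => S' [S'S /existsNP[x /not_implyP[Sx nS'x]]]; apply: IH.
apply: leq_trans (_ : #|img S| <= _); last by rewrite -ltnS.
apply: proper_card; apply/properP; split.
  by apply/fintype.subsetP => u; rewrite !inE => -[y S'y <-]; exists y => //;
    exact: S'S.
exists (f x); first by rewrite inE; apply/asboolP; exists x.
apply/negP; rewrite inE => /asboolP[y S'y /finj yx].
by apply: nS'x; rewrite -yx.
Qed.

Lemma finite_fun (T U : Type) :
  finite_set [set: T] -> finite_set [set: U] -> finite_set [set: T -> U].
Proof.
move=> /finite_codeP[F [f finj]] /finite_codeP[F' [f' finj']].
apply/finite_codeP.
exists {set (F * F')%type}, (fun h =>
  [set p | `[< exists2 x, f x = p.1 & f' (h x) = p.2 >]]%SET).
move=> h h' /setP hh'; apply: funext => x.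
have := hh' (f x, f' (h x)); rewrite !inE.
have -> : `[< exists2 y, f y = f x & f' (h y) = f' (h x) >].
  by apply/asboolP; exists x.
by move=> /esym/asboolP[y /finj <- /finj' ->].
Qed.

Lemma finite_sub (T : Type) (S : set T) :
  finite_set [set: T] -> finite_set [set: {x | S x}].
Proof.
move=> /finite_codeP[F [f finj]]; apply/finite_codeP.
by exists F, (f \o sval); apply: inj_comp => //; exact: sval_inj.
Qed.

Lemma finite_prod (T U : Type) :
  finite_set [set: T] -> finite_set [set: U] -> finite_set [set: (T * U)%type].
Proof. by move=> Tfin Ufin; rewrite -setXTT; exact: finite_setX. Qed.

(** * Dismantling as a walk of retractions *)

(** Domination in the substructure induced by [S], stated in [X] so that subtypes do not nest as [S]
    shrinks. *)
Definition dominates_in (tau : signature) (X : structure tau) (S : set X)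
    (b a : X) : Prop :=
  forall (R : tau) (i : 'I_(arity R)) (t : 'I_(arity R) -> X),
    rel_of X R t -> (forall j, S (t j)) -> t i = a ->
    rel_of X R [eta t with i |-> b].

Lemma dominates_induced (tau : signature) (X : structure tau) (S : set X)
    (b a : induced X S) :
  dominates (induced X S) b a <-> dominates_in S (sval b) (sval a).
Proof.
have delta R (i : 'I_(arity R)) (t : 'I_(arity R) -> induced X S) :
    (fun j => sval ([eta t with i |-> b] j)) =
    [eta (fun j => sval (t j)) with i |-> sval b].
  by apply: funext => j /=; case: eqP.
split=> dom R i t.
  move=> Rt St ti; pose u j : induced X S := exist _ (t j) (St j).
  have ui : u i = a by apply: sval_inj.
  by have := dom R i u Rt ui; rewrite /= delta.
move=> Rt ti; rewrite /= delta; apply: dom => //; last by rewrite ti.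
by move=> j; exact: svalP.
Qed.

(** The coordinates are exchanged one at a time; the intermediate tuples stay in [S] because [b]
    does. *)
Lemma dominates_in_mix (tau : signature) (X : structure tau) (S : set X)
    (b a : X) (Sb : S b) (dom : dominates_in S b a) (R : tau)
    (t u : 'I_(arity R) -> X) :
  rel_of X R t -> (forall j, S (t j)) ->
  (forall j, u j = t j \/ t j = a /\ u j = b) -> rel_of X R u.
Proof.
move=> Rt St tu.
pose m (A : {set 'I_(arity R)}) j := if j \in A then u j else t j.
have mS A j : S (m A j).
  by rewrite /m; case: ifP => // _; case: (tu j) => [->|[_ ->]].
suff Rm : forall n (A : {set 'I_(arity R)}), #|A| = n -> rel_of X R (m A).
  have <- : m [set: 'I_(arity R)]%SET = u by apply: funext => j; rewrite /m inE.
  exact: Rm.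
elim=> [|n IH] A An.
  have -> : m A = t by apply: funext => j; rewrite /m (cards0_eq An) inE.
  exact: Rt.
have /card_gt0P[i iA] : 0 < #|A| by rewrite An.
have /IH RA : #|A :\ i| = n by move: An; rewrite (cardsD1 i) iA => -[].
have mE j : j != i -> m A j = m (A :\ i) j by rewrite /m !inE => ->.
have mi : m (A :\ i) i = t i by rewrite /m !inE eqxx.
case: (tu i) => [ui|[ta ub]].
  have -> // : m A = m (A :\ i).
  apply: funext => j; have [->|/mE//] := eqVneq j i.
  by rewrite mi /m iA.
have -> : m A = [eta m (A :\ i) with i |-> b].
  apply: funext => j /=; case: eqVneq => [->|/mE//].
  by rewrite /m iA.
by apply: dom => //; rewrite mi.
Qed.

Definition fold_step (tau : signature) (X : structure tau) (S S' : set X) :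
    Prop :=
  exists a b, [/\ S a, S b, a <> b, dominates_in S b a & S' = S `\ a].

Lemma dismantles_toP (tau : signature) (X : structure tau) (D : set X) :
  dismantles_to X D <-> conn (@fold_step tau X) setT [set: X] D.
Proof.
rewrite conn_seqP; split=> -[l [S]].
  move=> [[S0 Sstep] Sl]; exists l, S; split=> // i /Sstep[a [b [ab dom ->]]].
  exists (sval a), (sval b); split=> //; try exact: svalP.
    by move=> /sval_inj.
  by apply/dominates_induced.
move=> [S0 Sl _ Sstep]; exists l, S; do 2![split=> //] => j.
move=> /Sstep[a [b [Sa Sb ab dom ->]]].
exists (exist _ a Sa), (exist _ b Sb); split=> //; last exact/dominates_induced.
by move=> /(congr1 sval).
Qed.

Definition retraction_onto (tau : signature) (X : structure tau) (D : set X)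
    (r : X -> X) : Prop :=
  [/\ Hom X X r, forall x, D (r x) & forall x, D x -> r x = x].

Definition fixing (tau : signature) (X : structure tau) (D : set X) :
    set (X -> X) :=
  [set f | Hom X X f /\ forall x, D x -> f x = x].

Definition fold (T : Type) (a b x : T) : T := if `[< x = a >] then b else x.

(** A mixture of the two folded maps is a mixture of [f] and [g] with some entries [a] replaced by
    [b]. *)
Lemma fold_mix (tau : signature) (X G : structure tau) (S : set X) (a b : X)
    (f g : G -> X) :
  S b -> dominates_in S b a -> L_adj G X f g -> (forall x, S (f x)) ->
  (forall x, S (g x)) -> L_adj G X (fold a b \o f) (fold a b \o g).
Proof.
move=> Sb dom /L_adjP fg Sf Sg; apply/L_adjP => R x y Rx yE.
have /choice[z zE] : forall i, exists h : X,
    (h = f (x i) \/ h = g (x i)) /\ y i = fold a b h.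
  move=> i; case: (yE i) => ->; [exists (f (x i))|exists (g (x i))].
    by split=> //; left.
  by split=> //; right.
apply: (dominates_in_mix Sb dom (t := z)).
- by apply: fg Rx _ => i; exact: (zE i).1.
- by move=> i; case: (zE i).1 => ->.
- move=> i; rewrite (zE i).2 /fold; case: asboolP => [->|_]; last by left.
  by right.
Qed.

Lemma foldE (T : Type) (a b : T) : fold a b a = b.
Proof. by rewrite /fold asboolT. Qed.

Lemma fold_neq (T : Type) (a b x : T) : x <> a -> fold a b x = x.
Proof. by move=> xa; rewrite /fold asboolF. Qed.

Lemma fold_adj (tau : signature) (X G : structure tau) (S : set X) (a b : X)
    (f : G -> X) :
  S b -> dominates_in S b a -> Hom G X f -> (forall x, S (f x)) ->
  L_adj G X f (fold a b \o f).
Proof.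
move=> Sb dom fH Sf; apply/L_adjP => R x y Rx yE.
apply: (dominates_in_mix Sb dom (t := f \o x)) => // [|j|i]; [exact: fH|exact: Sf|].
case: (yE i) => ->; first by left.
by rewrite /= /fold; case: asboolP => xa; [right|left].
Qed.

Lemma conn_weaken (T : Type) (adj : T -> T -> Prop) (P Q : set T) x y :
  P `<=` Q -> conn adj P x y -> conn adj Q x y.
Proof. by move=> PQ; apply: (conn_map (m := id)). Qed.

(** Each fold, composed with the retraction [e] reached so far, adds one step to the walk. *)
Lemma dismantles_conn (tau : signature) (X : structure tau) (D : set X) :
  dismantles_to X D ->
  exists2 r, retraction_onto D r & conn (L_adj X X) (fixing D) id r.
Proof.
move=> /dismantles_toP XD.
suff main : forall S S' : set X, conn (@fold_step tau X) setT S S' ->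
    forall e, retraction_onto S e -> conn (L_adj X X) (fixing S) id e ->
    exists2 r, retraction_onto S' r & conn (L_adj X X) (fixing S') id r.
  by apply: (main _ _ XD); [split|apply: conn_refl; split].
move=> S S'; elim=> [{}S _ e|{}S U {}S' _ [a [b [Sa Sb ab dom ->]]] _ IH e].
  by exists e.
move=> [eH eS eid] ide.
have eadj := fold_adj Sb dom eH eS.
have feH : Hom X X (fold a b \o e) by apply: (@L_adj_homl _ _ _ _ e); exact: L_adj_sym.
have fixe x : (S `\ a) x -> e x = x by move=> [Sx _]; exact: eid.
have fixfe x : (S `\ a) x -> (fold a b \o e) x = x.
  by move=> [Sx xa]; rewrite /= eid // fold_neq.
apply: (IH (fold a b \o e)).
  split=> // x /=; have [->|nxa] := pselect (e x = a).
    by rewrite foldE; split=> // /esym.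
  by rewrite fold_neq.
apply: (@conn_trans _ _ _ e); last by apply: conn_adj.
by apply: conn_weaken ide => f [fH fS]; split=> // x [/fS].
Qed.

Lemma conn_dismantles (tau : signature) (X : structure tau) (D : set X)
    (r : X -> X) :
  finite_str X -> conn (L_adj X X) (fixing D) id r -> (forall x, D (r x)) ->
  dismantles_to X D.
Proof.
move=> finX idr Dr; apply/dismantles_toP.
(* The walk stays inside the current [S] and starts at a map that is the identity on [S]. *)
suff main : forall S : set X, forall e s,
    conn (L_adj X X) [set f | fixing D f /\ forall x, S (f x)] e s ->
    (forall x, S x -> e x = x) -> (forall x, D (s x)) ->
    conn (@fold_step tau X) setT S D.
  apply: (main _ id r) => //; apply: conn_weaken idr => f; by split.
apply: (finite_wf finX) => S IH e s es eS sD.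
have [sS|[h [f [[[hH hD] Sh] [[fH fD] Sf] hf hS /existsNP[a /not_implyP[Sa fa]]]]]] :=
    conn_escape (Q := fun f => forall x, S x -> f x = x) es eS.
  suff -> : S = D by exact: conn_refl.
  apply/seteqP; split=> [x /sS <-|x Dx]; first exact: sD.
  have [[_ eD] Se] := conn_start es.
  by rewrite -(eD x Dx); exact: Se.
have Da : ~ D a by move=> /fD.
(* Replacing one entry [a] by [f a] mixes [f] with [h], which is the identity on [S]. *)
have dom : dominates_in S (f a) a.
  move=> R i t Rt St ti; move/L_adjP: hf; apply; first exact: Rt.
  move=> j /=; case: eqVneq => [->|_]; first by right; rewrite ti.
  by left; rewrite hS.
have step : fold_step S (S `\ a) by exists a, (f a); split=> //; exact: nesym.
apply: conn_step step _ => //.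
(* Folding [a] onto [f a] pushes the whole walk into [S] without [a]; no point of [D] moves, as [a]
   is outside [D]. *)
apply: (IH _ _ (fold a (f a) \o e) (fold a (f a) \o s)).
- by split=> [x []//|/(_ a Sa)[_ /(_ erefl)]].
- apply: conn_map es => [u [[uH uD] Su]|u v [[uH uD] Su] [[vH vD] Sv] uv].
    split=> [|x /=].
      split; first exact: L_adj_homl (fold_mix (Sf a) dom (L_adj_refl uH) Su Su).
      by move=> x Dx /=; rewrite uD // fold_neq // => xa; rewrite -xa in Da.
    have [->|nua] := pselect (u x = a); last by rewrite fold_neq.
    by rewrite foldE; split=> // /esym.
  exact: fold_mix (Sf a) dom uv Su Sv.
- by move=> x [Sx xa] /=; rewrite eS // fold_neq.
- by move=> x /=; rewrite fold_neq // => sa; rewrite -sa in Da; exact: Da.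
Qed.

(** * Stiff cores *)

Definition stiff (tau : signature) (X : structure tau) (J S : set X) : Prop :=
  forall a b, S a -> S b -> ~ J a -> dominates_in S b a -> a = b.

Lemma stiff_core (tau : signature) (X : structure tau) (J : set X) :
  finite_str X ->
  exists I : set X, [/\ dismantles_to X I, J `<=` I & stiff J I].
Proof.
move=> finX.
suff main : forall S : set X, J `<=` S ->
    exists I, [/\ conn (@fold_step tau X) setT S I, J `<=` I & stiff J I].
  have [//|I [XI JI Istiff]] := main setT.
  by exists I; split=> //; apply/dismantles_toP.
apply: (finite_wf finX) => S IH JS.
have [Sstiff|] := pselect (stiff J S).
  by exists S; split=> //; exact: conn_refl.
move=> /existsNP[a /existsNP[b /not_implyP[Sa /not_implyP[Sb]]]].
move=> /not_implyP[Ja /not_implyP[dom ab]].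
have [||I [SI JI Istiff]] := IH (S `\ a).
- by split=> [x []//|/(_ a Sa)[_ /(_ erefl)]].
- by move=> x Jx; split; [exact: JS|move=> xa; rewrite -xa in Ja].
- exists I; split=> //; apply: conn_step SI => //; exists a, b; split=> //.
Qed.

Lemma corestriction (tau : signature) (X : structure tau) (I : set X)
    (r : X -> X) :
  retraction_onto I r ->
  exists r' : X -> induced X I,
    [/\ Hom X (induced X I) r', forall x, sval (r' x) = r x &
        forall y, r' (sval y) = y].
Proof.
move=> [rH rI rid]; exists (fun x => exist _ (r x) (rI x)); split=> //.
by move=> y; apply: sval_inj; rewrite /= rid //; exact: svalP.
Qed.

(** * Squares and walks between the two projections *)

(** The walk from [id] to [r] projects to walks from [fst] and from [snd]; their ends coincide
    because [r] maps into the diagonal. *)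
Lemma square_dismantles_conn (tau : signature) (X : structure tau)
    (K : set (square X)) :
  dismantles_to (square X) K -> K `<=` diag [set: X] ->
  conn (L_adj (square X) X)
    [set f | Hom (square X) X f /\ forall a, K (a, a) -> f (a, a) = a] fst snd.
Proof.
move=> /dismantles_conn[r [rH rK rid] idr] Kdiag.
apply: (@conn_trans _ _ _ (fst \o r)).
  apply: (conn_map (m := fun f => fst \o f)) idr => [f [fH fK]|f g _ _ fg].
    by split=> [|a /fK /= ->//]; exact: Hom_comp fH (@Hom_fst _ _ _).
  exact: L_adj_post fg (@Hom_fst _ _ _).
have -> : fst \o r = snd \o r.
  by apply: funext => x /=; have [a _ <-] := Kdiag _ (rK x).
apply: conn_sym; first exact: L_adj_sym.
apply: (conn_map (m := fun f => snd \o f)) idr => [f [fH fK]|f g _ _ fg].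
  by split=> [|a /fK /= ->//]; exact: Hom_comp fH (@Hom_snd _ _ _).
exact: L_adj_post fg (@Hom_snd _ _ _).
Qed.

Definition fixes_diag (tau : signature) (X : structure tau) (J : set X) :
    set (square X -> X) :=
  [set f | Hom (square X) X f /\ forall a, J a -> f (a, a) = a].

Lemma keeps_proj (tau : signature) (X : structure tau) (J : set X) :
  keeps J (fst : square X -> X) snd = fixes_diag J.
Proof.
apply/seteqP; split=> f [fH fJ]; split=> //.
  by move=> a Ja; exact: (fJ (a, a)).
by move=> [a b] /= <- /fJ.
Qed.

(** The walk from [id] to [r] runs in both coordinates at once, and then the walk on the square of
    the substructure follows, composed with [rr] and [out]. *)
Lemma square_square_dismantles (tau : signature) (H : structure tau)
    (I : set H) :
  finite_str H -> dismantles_to H I ->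
  dismantles_to (square (induced H I)) (diag [set: induced H I]) ->
  dismantles_to (square H) (diag I).
Proof.
move=> finH /dismantles_conn[r rret idr] /dismantles_conn[q [qH qD qid] idq].
have [r' [r'H r'E r'K]] := corestriction rret.
pose Y := square (induced H I).
pose rr (x : square H) : Y := (r' x.1, r' x.2).
pose out (y : Y) : square H := (sval y.1, sval y.2).
have outH : Hom Y (square H) out by move=> R t [].
have rrH : Hom (square H) Y rr.
  by apply: Hom_pair; apply: Hom_comp r'H; [exact: Hom_fst|exact: Hom_snd].
have fixout a : I a -> out (rr (a, a)) = (a, a).
  by move=> Ia; case: rret => _ _ rid; rewrite /out /= !r'E rid.
apply: (@conn_dismantles _ _ _ (out \o q \o rr)).
- exact: finite_prod.
- apply: (@conn_trans _ _ _ (out \o rr)).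
    have -> : out \o rr = fun x => (r x.1, r x.2).
      by apply: funext => x; rewrite /out /= !r'E.
    have -> : id = fun x : square H => (x.1, x.2) by apply: funext; case.
    apply: (conn_map (m := fun f (x : square H) => (f x.1, f x.2) : square H)) idr.
      move=> f [fH fI]; split=> [R t [t1 t2]|x [a Ia <-]]; last by rewrite /= fI.
      by split; [exact: (fH _ _ t1)|exact: (fH _ _ t2)].
    move=> f g _ _ /L_adjP fg; apply/L_adjP => R t y [t1 t2] yE.
    split; [apply: fg t1 _|apply: fg t2 _] => i /=;
      by case: (yE i) => ->; [left|right].
  apply: (conn_map (m := fun f => out \o f \o rr)) idq.
    move=> f [fH fD]; split=> [|x [a Ia <-] /=].
      by apply: Hom_comp rrH _; exact: Hom_comp fH outH.
    by rewrite fD; [exact: fixout|exists (r' a)].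
  move=> f g _ _ fg; apply: L_adj_comp rrH; exact: L_adj_post outH.
- move=> x /=; have [u _ <-] := qD (rr x).
  by exists (sval u) => //; exact: svalP.
Qed.

Lemma sub_dismantles (tau : signature) (H : structure tau) (J : set H) :
  finite_str H -> conn (L_adj (square H) H) (fixes_diag J) fst snd ->
  exists I : set H, [/\ dismantles_to H I, J `<=` I &
    dismantles_to (square (induced H I)) (diag [set: induced H I])].
Proof.
move=> finH walk.
have [I [HI JI Istiff]] := stiff_core J finH; exists I; split=> //.
have [r rret _] := dismantles_conn HI.
have [r' [r'H r'E r'K]] := corestriction rret.
pose X := induced H I; pose Y := square X.
pose out (y : Y) : square H := (sval y.1, sval y.2).
have outH : Hom Y (square H) out by move=> R t [].
pose dg (x : X) : square H := (sval x, sval x).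
have dgH : Hom X (square H) dg by move=> R t Rt; split.
(* Only the second coordinate moves: [m snd] is the identity and [m fst] maps into the diagonal. *)
pose m (f : square H -> H) (y : Y) : Y := (y.1, r' (f (out y))).
pose Q := [set f : square H -> H | forall x : X, r' (f (dg x)) = x].
have {}walk : conn (L_adj (square H) H) (fixes_diag J `&` Q) fst snd.
  apply: conn_invariant walk; last by move=> x; exact: r'K.
  move=> f g [fH fJ] [gH gJ] fg Qf x.
  have [Jx|nJx] := pselect (J (sval x)); first by rewrite /dg gJ // r'K.
  (* As [f], retracted to [I], is the identity on the diagonal, the next map sends [x] to an element
     dominating it, which stiffness forces to be [x]. *)
  apply: sval_inj; apply/esym/Istiff => //; try exact: svalP.
  apply/dominates_induced => R i t Rt ti.
  have /L_adjP : L_adj X X (r' \o f \o dg) (r' \o g \o dg).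
    by apply: L_adj_comp dgH; exact: L_adj_post r'H.
  apply; first exact: Rt.
  move=> j /=; case: eqVneq => [->|_]; first by right; rewrite ti.
  by left; rewrite Qf.
apply: (@conn_dismantles _ _ _ (m fst)).
- by apply: finite_prod; exact: finite_sub.
- apply: conn_sym; first exact: L_adj_sym.
  have -> : id = m snd by apply: funext => -[y1 y2]; rewrite /m /= r'K.
  apply: conn_map walk => [f [[fH _] Qf]|f g _ _ fg].
    split=> [|y [x _ <-]]; last by rewrite /m /= Qf.
    apply: Hom_pair; first exact: Hom_fst.
    by apply: Hom_comp r'H; exact: Hom_comp outH fH.
  apply: L_adj_pair; first exact: Hom_fst.
  apply: (@L_adj_post _ _ _ _ (f \o out) (g \o out)) r'H.
  exact: L_adj_comp outH.
- by move=> y; exists y.1 => //; rewrite /m /= r'K.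
Qed.

Lemma walk_joined (tau : signature) (H G : structure tau) (J : set H)
    (phi psi : G -> H) :
  conn (L_adj (square H) H) (fixes_diag J) fst snd ->
  Hom G H phi -> Hom G H psi ->
  conn (L_adj G H) (keeps J phi psi) phi psi.
Proof.
move=> walk phiH psiH; have pH := Hom_pair phiH psiH.
apply: (conn_map (m := fun f x => f (phi x, psi x))) walk.
  move=> f [fH fJ]; split=> [|x <- Jx]; last exact: fJ.
  exact: Hom_comp pH fH.
by move=> f g _ _ fg; exact: L_adj_comp fg pH.
Qed.

(** * Distances *)

Fixpoint ball (tau : signature) (G : structure tau) (V : set G) (n : nat) :
    set G :=
  if n is n'.+1 then
    ball V n' `|` [set x | exists (R : tau) (t : 'I_(arity R) -> G) i j,
                     [/\ rel_of G R t, t i = x & ball V n' (t j)]]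
  else V.

(** As the balls grow with [k], this is the minimum of [n] and the distance from [V] to [x]. *)
Definition capdist (tau : signature) (G : structure tau) (V : set G) (n : nat)
    (x : G) : nat :=
  \sum_(k < n) `[< ~ ball V k x >].

Lemma capdist0 (tau : signature) (G : structure tau) (V : set G) n x :
  V x -> capdist V n x = 0.
Proof.
move=> Vx; rewrite /capdist big1 // => k _; rewrite asboolF // => nB; apply: nB.
by elim: (nat_of_ord k) => [//|m IH]; left.
Qed.

Lemma capdist_max (tau : signature) (G : structure tau) (V : set G) n x :
  (forall k, k < n -> ~ ball V k x) -> capdist V n x = n.
Proof.
move=> nB; rewrite /capdist -[RHS]card_ord -sum1_card; apply: eq_bigr => k _.
by rewrite asboolT //; exact: nB.
Qed.

Lemma capdist_le (tau : signature) (G : structure tau) (V : set G) n x :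
  capdist V n x <= n.
Proof.
rewrite -[n in leqRHS]card_ord -sum1_card; apply: leq_sum => k _; exact: leq_b1.
Qed.

(** If [t j] is in ball [k] then [t i] is in ball [k.+1]: the sums compare after a shift by one
    term, which costs at most 1. *)
Lemma capdist_lip (tau : signature) (G : structure tau) (V : set G) n
    (R : tau) (t : 'I_(arity R) -> G) i j :
  rel_of G R t -> capdist V n (t i) <= (capdist V n (t j)).+1.
Proof.
move=> Rt; case: n => [|n]; first by rewrite /capdist big_ord0.
rewrite /capdist big_ord_recl [X in _ <= X.+1]big_ord_recr /= -add1n.
apply: leq_add; first exact: leq_b1.
apply: leq_trans (leq_addr _ _); apply: leq_sum => k _.
case: (asboolP (~ ball V k (t j))) => [_|/contrapT Bj]; first exact: leq_b1.
by rewrite asboolF // => nB; apply: nB; right; exists R, t, i, j.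
Qed.

Lemma ball_walk (tau : signature) (G : structure tau) (V : set G) n x :
  ball V n x -> exists w : pre_walk G,
    [/\ is_walk w, V (walk_start w), walk_end w = x & walk_length w <= n].
Proof.
elim: n x => [|n IH] x; first by exists (Start x).
case=> [/IH[w [ww Vw wE wn]]|[R [t [i [j [Rt <- /IH[w [ww Vw wE wn]]]]]]]].
  by exists w; split=> //; exact: leqW.
have [ij|ij] := eqVneq i j; first by exists w; rewrite ij; split=> //; exact: leqW.
exists (Extend w t j i); split=> //=; split=> //.
by move=> ji; rewrite ji eqxx in ij.
Qed.

Lemma ball_finite (tau : signature) (G : structure tau) (V : set G) n :
  locally_finite G -> finite_set V -> finite_set (ball V n).
Proof.
move=> Gfin Vfin; elim: n => [//|n IH] /=; rewrite finite_setU; split=> //.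
apply: (@sub_finite_set _ _ (\bigcup_(y in ball V n)
    \bigcup_(p in [set p : {R : tau & 'I_(arity R) -> G} |
                 rel_of G (tag p) (tagged p) /\ exists i, tagged p i = y])
      (tagged p @` setT))).
  move=> x [R [t [i [j [Rt <- Bj]]]]]; exists (t j) => //.
  by exists (existT _ R t); [split=> //; exists j|exists i].
apply: bigcup_finite => // y _; apply: bigcup_finite => // p _.
by apply: finite_image; exact: finite_finset.
Qed.

(** * Mixing *)

(** The gap is the length of the walk; the capped distance to [V], which is 0 on [V] and [g] on [W],
    tells which map of the walk is used at a point. *)
Lemma walk_irreducible (tau : signature) (H : structure tau) (J : set H) :
  conn (L_adj (square H) H) (fixes_diag J) fst snd ->
  exists g, forall G : structure tau, strongly_irreducible G H J g.
Proof.
move=> walk.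
have [|g [f [f0 fg fP fadj]]] := conn_stationary _ walk.
  by move=> f [fH _]; exact: L_adj_refl.
exists g => G V W VW phi psi phiH psiH.
exists (fun x => f (capdist V g x) (phi x, psi x)); split.
- move=> R t Rt.
  apply: (rel_time_mix (h := fun i x => f i (phi x, psi x)) _ Rt).
    by move=> i; apply: L_adj_comp (fadj i) _; exact: Hom_pair.
  by move=> i j; exact: capdist_lip.
- by move=> x Vx; rewrite capdist0 // f0.
- move=> x Wx; rewrite capdist_max ?fg // => k kg /ball_walk[w [ww Vw wE wk]].
  have := VW w ww Vw; rewrite wE => /(_ Wx); lia.
- move=> x <- Jx; exact: (fP _).2.
Qed.

Lemma lip_dist_ge (tau : signature) (G : structure tau) (len : G -> nat)
    (x : G) (g : nat) :
  (forall (R : tau) (t : 'I_(arity R) -> G) i j,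
     rel_of G R t -> len (t i) <= (len (t j)).+1) ->
  len x = 0 -> dist_ge G [set x] [set y | g <= len y] g.
Proof.
move=> lip lenx w ww /= wx; suff : len (walk_end w) <= walk_length w by lia.
elim: w ww wx => [y _ /= ->|w IH R t i j [/IH{}IH Rt _ ti] /IH{}IH] /=.
  by rewrite lenx.
by apply: leq_trans (lip R t j i Rt) _; rewrite ltnS ti.
Qed.

(* The stiffness of I forces gamma to be the identity on diagonal vertices and,
   the stiffness of K then forces (end_1, gamma) to be the identity on K; both
   propagate from the vertices of level at least g down to level 0. *)
Lemma unfolding_dismantles (tau : signature) (H G : structure tau) (J : set H)
    (e : G -> square H) (len : G -> nat) (g : nat) :
  finite_str H -> Hom G (square H) e ->
  (forall p, exists2 x, e x = p & len x = 0) ->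
  (forall (R : tau) (t : 'I_(arity R) -> square H) i w,
     rel_of (square H) R t -> e w = t i ->
     exists u : 'I_(arity R) -> G, [/\ rel_of G R u, u i = w, e \o u = t &
       forall j, j <> i -> len (u j) = (len w).+1]) ->
  (forall x, len x = 0 -> mixing G H J [set x] [set y | g <= len y]) ->
  exists I : set H, [/\ dismantles_to H I, J `<=` I &
    dismantles_to (square (induced H I)) (diag [set: induced H I])].
Proof.
move=> finH eH start ext mix.
have [I [HI JI Istiff]] := stiff_core J finH; exists I; split=> //.
have [r rret _] := dismantles_conn HI.
have [r' [r'H r'E r'K]] := corestriction rret.
pose X := induced H I; pose Y := square X.
pose out (y : Y) : square H := (sval y.1, sval y.2).
have finY : finite_str Y by apply: finite_prod; exact: finite_sub.
have [K [YK DK Kstiff]] := stiff_core (diag [set: X] : set Y) finY.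
have [q qret _] := dismantles_conn YK; case: (qret) => qH qK qid.
suff <- : K = (diag [set: X] : set Y) by [].
apply/seteqP; split=> // p Kp; apply: contrapT => nDp.
have [x0 ex0 lenx0] := start (out p).
(* [x0] lies over [p]: there [gam] is the first coordinate, while from level [g] on it is the
   second. *)
have [gam [gamH gamx gamW gamJ]] :=
  mix x0 lenx0 (fst \o e) (snd \o e) (Hom_comp eH (@Hom_fst _ _ _))
    (Hom_comp eH (@Hom_snd _ _ _)).
(* [n] bounds the number of levels still missing to [g]; the lifted tuple through [w] has its other
   entries one level higher, where induction applies. *)
have diagE n w (a : X) : g <= len w + n -> e w = out (a, a) -> r' (gam w) = a.
  elim: n w a => [|n IH] w a gn ew.
    by rewrite gamW /= ?ew ?r'K //; move: gn; rewrite addn0.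
  have [Ja|nJa] := pselect (J (sval a)).
    by rewrite gamJ /= ew ?r'K.
  apply: sval_inj; apply/esym/Istiff => //; try exact: svalP.
  apply/dominates_induced => R i t Rt ti.
  have [||u [Ru ui eu ulen]] := ext R (fun j => out (t j, t j)) i w.
  - by split.
  - by rewrite ti.
  have <- : r' \o gam \o u = [eta t with i |-> r' (gam w)]; last first.
    exact: (r'H _ _ (gamH _ _ Ru)).
  apply: funext => j /=; case: eqVneq => [->|ji]; first by rewrite ui.
  apply: IH; last exact: (congr1 (@^~ j) eu).
  by rewrite ulen; [move: gn; rewrite addnS addSn|exact/eqP].
have KE n w (y : Y) : g <= len w + n -> K y -> e w = out y ->
    q (y.1, r' (gam w)) = y.
  elim: n w y => [|n IH] w y gn Ky ew.
    have -> : r' (gam w) = y.2; last by case: y Ky ew => ? ? Ky ew; exact: qid.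
    by rewrite gamW /= ?ew ?r'K //; move: gn; rewrite addn0.
  have [[a _ ya]|nDy] := pselect (diag [set: X] y).
    rewrite -ya /= (@diagE n.+1 w a) //; last by rewrite ew -ya.
    by apply: qid; apply: DK; exists a.
  apply/esym/Kstiff => //; move=> R i t Rt Kt ti.
  have [||u [Ru ui eu ulen]] := ext R (out \o t) i w.
  - by case: Rt; split.
  - by rewrite /= ti.
  pose v j : Y := ((t j).1, r' (gam (u j))).
  have <- : q \o v = [eta t with i |-> q (y.1, r' (gam w))]; last first.
    by apply: qH; split; [exact: Rt.1|exact: (r'H _ _ (gamH _ _ Ru))].
  apply: funext => j /=; case: eqVneq => [->|ji]; first by rewrite /v ui ti.
  apply: IH => //; last exact: (congr1 (@^~ j) eu).
  by rewrite ulen; [move: gn; rewrite addnS addSn|exact/eqP].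
apply: nDp; exists p.1 => //.
(* At [x0] this reads [q (p.1, p.1) = p], but [q] fixes the diagonal, so [p] would lie on it. *)
have <- : q (p.1, r' (gam x0)) = p by apply: (KE g x0) => //; exact: leq_addl.
rewrite gamx //= ex0 r'K qid //; apply: DK; exists p.1 => //.
Qed.

(** * Local modifications *)

Lemma C_adj1_sub (tau : signature) (G H : structure tau) (f g : G -> H) (y : G) :
  (forall x, x <> y -> f x = g x) -> C_adj 1 G H f g.
Proof.
move=> fg; apply: (@card_le_trans _ _ _ [set y]); last first.
  by have := @card_set1 _ y; rewrite card_eq_le => /andP[].
by apply: subset_card_le => x /= nfg; apply: contrapT => /fg.
Qed.

Lemma C_adj_sym (tau : signature) (G H : structure tau) n (f g : G -> H) :
  C_adj n G H f g -> C_adj n G H g f.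
Proof.
rewrite /C_adj; suff -> : [set x | f x <> g x] = [set x | g x <> f x] by [].
by apply/seteqP; split=> x /nesym.
Qed.

(** The values are changed one point at a time along a list of the differences; each intermediate
    map mixes [f] and [g], so it is a homomorphism. *)
Lemma L_adj_C_conn (tau : signature) (G H : structure tau) (f g : G -> H) :
  L_adj G H f g -> finite_set [set x | f x <> g x] ->
  conn (C_adj 1 G H) [set h | Hom G H h /\ forall x, h x = f x \/ h x = g x] f g.
Proof.
move=> fg /(@finite_seqP {classic G})[s sE].
have {sE} : forall x : {classic G}, f x <> g x -> x \in s.
  by move=> x nfg; have : [set` s] x by rewrite -sE.
elim: s f fg => [|y s IH] f fg fgs.
  have -> : f = g by apply: funext => x; apply: contrapT => /fgs.
  by apply: conn_refl; split=> [|x]; [exact: L_adj_homl (L_adj_sym fg)|left].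
pose f1 (x : {classic G}) := if x == y then g x else f x.
have f1E x : f1 x = f x \/ f1 x = g x by rewrite /f1; case: ifP; [right|left].
have f1g : L_adj G H f1 g.
  apply/L_adjP => R x z Rx zE; move/L_adjP: fg; apply; first exact: Rx.
  by move=> i; case: (zE i) => ->; [exact: f1E|right].
have Pf1 : Hom G H f1 := L_adj_homl f1g.
apply: (conn_step (y := f1)).
- by split=> [|x]; [exact: L_adj_homl fg|left].
- by apply: (@C_adj1_sub _ _ _ _ _ y) => x xy; rewrite /f1; case: eqP.
- have f1s (x : {classic G}) : f1 x <> g x -> x \in s.
    by rewrite /f1; case: ifP => // xy /fgs; rewrite in_cons xy.
  apply: conn_weaken (IH _ f1g f1s) => h [hH hE]; split=> // x.
  by case: (hE x) => ->; [exact: f1E|right].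
Qed.

(** A clock [s] runs from 0 to [N], and the time at [x] is [minn s (c x)]. A mixture of the times
    for [s] and [s.+1] still varies by at most 1 inside a tuple, and only the finitely many points
    with positive [c] ever move. *)
Lemma time_shift_conn (tau : signature) (G H : structure tau) (I : set H)
    (f : nat -> H -> H) (c : G -> nat) (N : nat) (phi : G -> H) :
  f 0 = id -> (forall i, fixing I (f i)) -> (forall i, L_adj H H (f i) (f i.+1)) ->
  (forall (R : tau) (t : 'I_(arity R) -> G) i j,
     rel_of G R t -> c (t i) <= (c (t j)).+1) ->
  (forall x, c x <= N) -> finite_set [set x | 0 < c x] -> Hom G H phi ->
  conn (C_adj 1 G H) [set h | Hom G H h /\ forall x, I (phi x) -> h x = phi x]
    phi (fun x => f (c x) (phi x)).
Proof.
move=> f0 fP fadj cLip cN cfin phiH.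
pose h s x := f (minn s (c x)) (phi x).
have hL s : L_adj G H (h s) (h s.+1).
  apply/L_adjP => R x y Rx yE.
  have /choice[m mE] : forall i, exists m,
      (m = minn s (c (x i)) \/ m = minn s.+1 (c (x i))) /\ y i = f m (phi (x i)).
    move=> i; case: (yE i) => ->.
      by exists (minn s (c (x i))); split=> //; left.
    by exists (minn s.+1 (c (x i))); split=> //; right.
  have -> : y = fun i => f (m i) (phi (x i)) by apply: funext => i; exact: (mE i).2.
  apply: (rel_time_mix (h := fun i x => f i (phi x)) _ Rx).
    by move=> i; exact: L_adj_comp (fadj i) phiH.
  move=> i j; have := cLip R x i j Rx.
  by case: (mE i) => -[] -> _; case: (mE j) => -[] -> _; lia.
have -> : (fun x => f (c x) (phi x)) = h N.
  by apply: funext => x; rewrite /h (minn_idPr (cN x)).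
elim: N {cN} => [|s IH].
  have -> : h 0 = phi by apply: funext => x; rewrite /h min0n f0.
  by apply: conn_refl; split.
apply: conn_trans IH _; apply: conn_weaken (L_adj_C_conn (hL s) _).
  move=> k [kH kE]; split=> // x Ix.
  by case: (kE x) => ->; exact: (fP _).2.
apply: sub_finite_set cfin => x /=; rewrite /h; case: (c x) => //.
Qed.

Lemma locally_finite_conn (tau : signature) (G H : structure tau)
    (I : set H) (phi psi : G -> H) :
  dismantles_to H I ->
  dismantles_to (square (induced H I)) (diag [set: induced H I]) ->
  locally_finite G -> Hom G H phi -> Hom G H psi ->
  finite_set [set x | phi x <> psi x] ->
  conn (C_adj 1 G H) (keeps I phi psi) phi psi.
Proof.
move=> /dismantles_conn[r rret idr] /square_dismantles_conn walk Gfin phiH psiH.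
have [r' [r'H r'E r'K]] := corestriction rret.
set S := [set x | _] => Sfin; pose X := induced H I.
have [|N [f [f0 fN fP fadj]]] := conn_stationary _ idr.
  by move=> u [uH _]; exact: L_adj_refl.
(* The cap is [N.+1] so that all entries of a tuple meeting [S] have [c] at least [N], where the
   retraction is complete; [c] vanishes beyond distance [N] from [S]. *)
pose c x := N.+1 - capdist S N.+1 x.
have cLip (R : tau) (t : 'I_(arity R) -> G) i j :
    rel_of G R t -> c (t i) <= (c (t j)).+1.
  move=> Rt; have := capdist_lip S N.+1 j i Rt.
  by rewrite /c; have := capdist_le S N.+1; lia.
have cN x : c x <= N.+1 by rewrite /c; exact: leq_subr.
have cfin : finite_set [set x | 0 < c x].
  apply: (@sub_finite_set _ _ (\bigcup_(k in `I_N.+1) ball S k)); last first.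
    by apply: bigcup_finite => // k _; exact: ball_finite.
  move=> x /= cx; apply: contrapT => nB; move: cx.
  rewrite /c capdist_max ?subnn // => k kN Bk; apply: nB.
  by exists k.
have shift theta := time_shift_conn f0 fP fadj cLip cN cfin (phi := theta).
pose shifted (theta : G -> H) x := f (c x) (theta x).
have shiftedH : Hom G H (shifted phi) := (conn_end (shift _ phiH)).1.
have shiftedE theta x : N <= c x -> shifted theta x = r (theta x).
  by move=> xN; rewrite /shifted fN.
have cS x : S x -> c x = N.+1 by move=> Sx; rewrite /c capdist0.
have nSE x : ~ S x -> phi x = psi x by move=> /contrapT.
(* For [F] fixing the diagonal, both branches give [shifted phi] off [S], where [phi] and [psi]
   agree. *)
pose m (F : square X -> X) x :=
  if N <= c x then sval (F (r' (phi x), r' (psi x))) else shifted phi x.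
have pairH := Hom_pair (Hom_comp phiH r'H) (Hom_comp psiH r'H).
pose P := [set F | Hom (square X) X F /\
                   forall a, diag [set: X] (a, a) -> F (a, a) = a].
have diagE F x : P F -> phi x = psi x -> sval (F (r' (phi x), r' (psi x))) = r (phi x).
  by move=> [_ FD] <-; rewrite FD ?r'E //; exists (r' (phi x)).
have mnS F x : P F -> ~ S x -> m F x = shifted phi x.
  move=> PF /nSE xE; rewrite /m; case: ifP => // xN.
  by rewrite diagE // shiftedE.
have mL F F' : P F -> P F' -> L_adj (square X) X F F' -> L_adj G H (m F) (m F').
  move=> PF PF' FF'; apply/L_adjP => R x y Rx yE.
  (* A tuple missing [S] sees only [shifted phi]; one meeting [S] lies wholly where [c] is at least
     [N], and there [F] and [F'] may be mixed. *)
  have [[j Sj]|nS] := pselect (exists j, S (x j)); last first.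
    have -> : y = shifted phi \o x; last exact: shiftedH.
    apply: funext => i; have nSi : ~ S (x i) by move=> Si; apply: nS; exists i.
    by case: (yE i) => ->; rewrite mnS.
  have xN i : N <= c (x i) by have := cLip R x j i Rx; rewrite cS.
  have /L_adjP : L_adj G H
      (fun z => sval (F (r' (phi z), r' (psi z))))
      (fun z => sval (F' (r' (phi z), r' (psi z)))).
    exact: L_adj_comp (L_adj_post FF' (@Hom_sval _ _ I)) pairH.
  by apply; first exact: Rx; move=> i; have := yE i; rewrite /m xN.
have mP F : P F -> keeps I phi psi (m F).
  move=> PF; split=> [|x xE Ix].
    by apply: L_adj_homl (mL F F PF PF _); case: PF => FH _; exact: L_adj_refl.
  rewrite mnS //.
  by rewrite /shifted (fP _).2.
have walk' : conn (C_adj 1 G H) (keeps I phi psi) (m fst) (m snd).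
  apply: (conn_bind mP) (walk _) => //.
  move=> F F' PF PF' FF'; apply: conn_weaken (L_adj_C_conn (mL _ _ PF PF' FF') _).
    move=> h [hH hE]; split=> // x xE Ix.
    by case: (hE x) => ->; apply: (mP _ _).2.
  by apply: sub_finite_set Sfin => x; apply: contra_not => nSx; rewrite !mnS.
have mfst : m fst = shifted phi.
  by apply: funext => x; rewrite /m; case: ifP => //= xN; rewrite r'E shiftedE.
have msnd : m snd = shifted psi.
  apply: funext => x; rewrite /m; case: ifP => /= xN; first by rewrite r'E shiftedE.
  rewrite /shifted nSE // => Sx; move: xN.
  by rewrite cS // leqnSn.
rewrite mfst msnd in walk'.
apply: (conn_trans _ (conn_trans walk' _)).
  by apply: conn_weaken (shift _ phiH) => h [hH hE]; split=> // x _; exact: hE.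
apply: conn_sym; first exact: C_adj_sym.
apply: conn_weaken (shift _ psiH) => h [hH hE]; split=> // x xE Ix.
by rewrite hE -xE.
Qed.

(** * Test structures *)

Definition reduct (tau : signature) (G : structure tau) (T : set tau) :
    structure tau :=
  @Structure tau G (fun R => [set t | T R /\ rel_of G R t]).

(* A finite structure need not be locally finite, as [tau] may be infinite;
   but finitely many symbols exclude all the maps that are not homomorphisms. *)
Lemma finite_reduct (tau : signature) (G H : structure tau) :
  finite_str G -> finite_str H ->
  exists T : set tau, locally_finite (reduct G T) /\
    forall f : G -> H, Hom (reduct G T) H f <-> Hom G H f.
Proof.
move=> finG finH.
have /choice[w wE] : forall f : G -> H, exists o : option tau,
    ~ Hom G H f -> exists R (t : 'I_(arity R) -> G),
      [/\ o = Some R, rel_of G R t & ~ rel_of H R (f \o t)].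
  move=> f; have [fH|nfH] := pselect (Hom G H f); first by exists None.
  have [R /existsNP[t /not_implyP[Rt nRt]]] : exists R,
      ~ forall t, rel_of G R t -> rel_of H R (f \o t).
    exact/existsNP.
  by exists (Some R) => _; exists R, t.
pose T := [set R : tau | range w (Some R)].
have finT : finite_set T.
  apply: (@finite_preimage _ _ (range w) Some) => [R R' _ _ []//|].
  by apply: finite_image; exact: finite_fun.
exists T; split=> [x|f].
  apply: (@sub_finite_set _ _ (\bigcup_(R in T)
      range (existT (fun R : tau => 'I_(arity R) -> G) R))).
    by move=> [R t] /= [[TR _] _]; exists R => //; exists t.
  apply: bigcup_finite => // R _; apply: finite_image.
  by apply: finite_fun => //; exact: finite_finset.
split=> [fH|fH R t [_ Rt]]; last exact: fH.
apply: contrapT => /wE[R [t [wf Rt]]]; apply; apply: fH; split=> //.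
by exists f.
Qed.

(** Connectivity depends on [G] only through its homomorphisms, so a locally finite reduct with the
    same ones serves. *)
Lemma finite_connected (tau : signature) (G H : structure tau) (J : set H) n :
  finite_str G -> finite_str H ->
  (forall G : structure tau, countable_str G -> locally_finite G ->
     connected_wrt G H J (C_adj n G H)) ->
  connected_wrt G H J (C_adj n G H).
Proof.
move=> finG finH lf phi psi phiH psiH fin.
have [T [Tlf TH]] := finite_reduct finG finH.
have := lf (reduct G T) (finite_set_countable finG) Tlf phi psi.
move=> /(_ ((TH _).2 phiH) ((TH _).2 psiH) fin)/joinedP walk.
apply/joinedP; apply: conn_weaken walk => f [fH fJ]; split=> //.
exact/TH.
Qed.

(** For [bool] this is the 1-link; a larger [E] provides more layers than a step in [C_n] can
    alter. *)
Definition full_str (tau : signature) (E : Type) : structure tau :=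
  @Structure tau E (fun R => [set: 'I_(arity R) -> E]).

(* Two maps that differ in at most [n] places agree on one of the layers
   [{e} * H^2], and any two layers of a homomorphism are adjacent in
   [L(H^2, H)]. *)
Lemma layers_walk (tau : signature) (E : finType) (e0 : E) (H : structure tau)
    (J : set H) n :
  n < #|E| -> finite_str H ->
  connected_wrt (prod_str (full_str tau E) (square H)) H J
    (C_adj n (prod_str (full_str tau E) (square H)) H) ->
  conn (L_adj (square H) H) (fixes_diag J) fst snd.
Proof.
move=> nE finH; set G := prod_str _ _ => conG.
have finG : finite_str G.
  by apply: finite_prod; [exact: finite_finset|exact: finite_prod].
pose p1 : G -> H := fst \o snd; pose p2 : G -> H := snd \o snd.
have p1H : Hom G H p1 := Hom_comp (@Hom_snd _ _ _) (@Hom_fst _ _ _).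
have p2H : Hom G H p2 := Hom_comp (@Hom_snd _ _ _) (@Hom_snd _ _ _).
have /joinedP walk := conG p1 p2 p1H p2H (sub_finite_set (@subsetT _ _) finG).
pose layer e (h : G -> H) (x : square H) := h (e, x).
have layerP e h : keeps J p1 p2 h -> fixes_diag J (layer e h).
  by move=> [hH hJ]; split=> [R t Rt|a Ja]; [exact: hH|exact: hJ].
have layer_adj e e' h : Hom G H h ->
    L_adj (square H) H (layer e h) (layer e' h).
  move=> hH; apply/L_adjP => R x y Rx yE.
  have /choice[z zE] : forall i, exists d, y i = h (d, x i).
    by move=> i; case: (yE i) => ->; [exists e|exists e'].
  have -> : y = h \o (fun i => (z i, x i)) by apply: funext => i; exact: zE.
  by apply: hH; split.
apply: (conn_bind (m := layer e0)) walk => [h|h h' hP hP' hh'].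
  exact: layerP.
have [e hE] : exists e, layer e h = layer e h'.
  apply: contrapT => /forallNP ne.
  have /choice[p pE] : forall e, exists x, h (e, x) <> h' (e, x).
    move=> e; apply: contrapT => /forallNP hE; apply: (ne e).
    by apply: funext => x; exact: contrapT (hE x).
  pose u (i : 'I_#|E|) : G := (enum_val i, p (enum_val i)).
  have uinj : {in [set: 'I_#|E|] &, injective u}.
    by move=> i j _ _ /(congr1 fst)/enum_val_inj.
  suff : (`I_#|E| #<= `I_n)%card by rewrite card_le_II leqNgt nE.
  apply: card_le_trans hh'; apply: (@card_le_trans _ _ _ (range u)).
    have : (`I_#|E| #= range u)%card.
      apply: card_eq_trans (card_II) _; rewrite card_eq_sym; exact: inj_card_eq uinj.
    by rewrite card_eq_le => /andP[].
  by apply: subset_card_le => _ [i _ <-]; exact: pE.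
(* From layer [e0] of [h] to the common layer [e], and from there to layer [e0] of [h']. *)
apply: (@conn_trans _ _ _ (layer e h)).
  by apply: conn_adj; [exact: layerP|exact: layerP|exact: layer_adj hP.1].
by rewrite hE; apply: conn_adj;
  [exact: layerP|exact: layerP|exact: layer_adj hP'.1].
Qed.

(** * Unfoldings of the square *)

(** A substitute for the forest of walks that remembers of a walk only its end and a level. *)
Definition leveled (tau : signature) (X : structure tau) : structure tau :=
  @Structure tau (X * nat)%type
    (fun R => [set t | rel_of X R (fst \o t) /\
                       forall i j, (t i).2 <= (t j).2.+1]).

Lemma leveled_dismantles (tau : signature) (H : structure tau) (J : set H) g :
  finite_str H -> strongly_irreducible (leveled (square H)) H J g ->
  exists I : set H, [/\ dismantles_to H I, J `<=` I &
    dismantles_to (square (induced H I)) (diag [set: induced H I])].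
Proof.
move=> finH irr.
apply: (@unfolding_dismantles _ _ (leveled (square H)) J fst snd g) => //.
- by move=> R t [].
- by move=> p; exists (p, 0).
- move=> R t i w Rt wE.
  exists (fun j => (t j, if j == i then w.2 else w.2.+1)); split=> //.
  + split=> // j k /=; case: ifP; case: ifP; lia.
  + by rewrite eqxx -wE; case: w {wE}.
  + by move=> j /eqP/negPf /= ->.
- by move=> x x0; apply/irr/lip_dist_ge => // R t i j [].
Qed.

(** A tuple through the end of a walk [w] lifts to the tuple formed by [w] and its one-step
    extensions, whose length is one more. *)
Lemma walk_forest_dismantles (tau : signature) (H : structure tau) (J : set H)
    g :
  finite_str H ->
  (forall (x : walk_forest (square H)) (W : set (walk_forest (square H))),
     dist_ge (walk_forest (square H)) [set x] W g ->
     mixing (walk_forest (square H)) H J [set x] W) ->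
  exists I : set H, [/\ dismantles_to H I, J `<=` I &
    dismantles_to (square (induced H I)) (diag [set: induced H I])].
Proof.
move=> finH mix; set T := walk_forest (square H) in mix.
pose e (w : T) : square H := walk_end (sval w).
pose len (w : T) := walk_length (sval w).
apply: (@unfolding_dismantles _ _ T J e len g) => //.
- move=> R u [t [i [Rt ui uj]]].
  suff -> : e \o u = t by [].
  apply: funext => j; have [->//|/eqP ji] := eqVneq j i.
  by rewrite /e /= uj.
- by move=> p; exists (exist _ (Start p) I).
- move=> R t i w Rt wE.
  have ext_walk j : j <> i -> is_walk (Extend (sval w) t i j).
    by move=> ji; split=> //; [exact: svalP|exact: nesym].
  pose u j : T := if pselect (j = i) is right ji then exist _ _ (ext_walk j ji) else w.
  have ui : u i = w by rewrite /u; case: pselect.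
  have uj j : j <> i -> sval (u j) = Extend (sval w) t i j.
    by rewrite /u; case: pselect.
  exists u; split=> //.
  + by exists t, i; rewrite ui.
  + apply: funext => j; have [->|/eqP ji] := eqVneq j i; first by rewrite /= ui.
    by rewrite /e /= uj.
  + by move=> j ji; rewrite /len uj.
- move=> x x0; apply/mix/lip_dist_ge => // R u i j [t [k [Rt _ uk]]].
  have uE l : len (u l) = len (u k) \/ len (u l) = (len (u k)).+1.
    have [->|/eqP lk] := eqVneq l k; first by left.
    by right; rewrite /len uk.
  by case: (uE i) => ->; case: (uE j) => ->; lia.
Qed.

(** * The cycle of implications *)

Theorem theorem3p6 (tau : signature) (H : structure tau) (finH : finite_str H)
    (J : set H) :
  [<->
    (* A1 *)
    exists I : set H, [/\ dismantles_to H I, J `<=` I &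
      dismantles_to (square (induced H I)) (diag [set: induced H I])];
    (* A2 *)
    exists K : set (square H), [/\ dismantles_to (square H) K,
      diag J `<=` K & K `<=` diag [set: H]];
    (* B1 *)
    forall G : structure tau, countable_str G -> locally_finite G ->
      connected_wrt G H J (C_adj 1 G H);
    (* B2 *)
    exists n : nat, 1 <= n /\
      forall G : structure tau, finite_str G ->
        connected_wrt G H J (C_adj n G H);
    (* B3 *)
    connected_wrt (prod_str (one_link tau) (square H)) H J
      (C_adj 1 (prod_str (one_link tau) (square H)) H);
    (* B4 *)
    forall G : structure tau, finite_str G ->
      connected_wrt G H J (L_adj G H);
    (* B5 *)
    joined (square H) H J (L_adj (square H) H) fst snd;
    (* C1 *)
    exists g : nat, forall G : structure tau, countable_str G ->
      strongly_irreducible G H J g;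
    (* C2 *)
    exists g : nat,
      forall (x : walk_forest (square H)) (W : set (walk_forest (square H))),
        dist_ge (walk_forest (square H)) [set x] W g ->
        mixing (walk_forest (square H)) H J [set x] W ].
Proof.
have finHH : finite_str (square H) by exact: finite_prod.
pose A1 := exists I : set H, [/\ dismantles_to H I, J `<=` I &
  dismantles_to (square (induced H I)) (diag [set: induced H I])].
pose walk := conn (L_adj (square H) H) (fixes_diag J) fst snd.
have walkP : joined (square H) H J (L_adj (square H) H) fst snd <-> walk.
  by rewrite joinedP keeps_proj.
have A2_walk (K : set (square H)) :
    [/\ dismantles_to (square H) K, diag J `<=` K & K `<=` diag [set: H]] -> walk.
  move=> [HK JK KD]; apply: conn_weaken (square_dismantles_conn HK KD).
  by move=> f [fH fK]; split=> // a Ja; apply/fK/JK; exists a.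
have A1_A2 : A1 -> exists K : set (square H), [/\ dismantles_to (square H) K,
    diag J `<=` K & K `<=` diag [set: H]].
  move=> [I [HI JI ID]]; exists (diag I); split.
  - exact: square_square_dismantles.
  - by move=> _ [a /JI Ia <-]; exists a.
  - by move=> _ [a _ <-]; exists a.
have walk_A1 : walk -> A1 by exact: sub_dismantles.
have A1_B1 : A1 -> forall G : structure tau, countable_str G ->
    locally_finite G -> connected_wrt G H J (C_adj 1 G H).
  move=> [I [HI JI ID]] G _ Gfin phi psi phiH psiH fin; apply/joinedP.
  apply: conn_weaken (locally_finite_conn HI ID Gfin phiH psiH fin).
  by move=> f [fH fI]; split=> // x xE /JI; exact: fI.
have walk_B4 : walk -> forall G : structure tau, connected_wrt G H J (L_adj G H).
  by move=> w G phi psi phiH psiH _; apply/joinedP; exact: walk_joined.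
tfae.
- exact: A1_A2.
- by move=> [K /A2_walk/walk_A1/A1_B1].
- by move=> B1; exists 1; split=> // G finG; exact: finite_connected.
(* With [n.+1] layers, one survives each step in [C_n], which yields (B5), hence (A1) and (B1); the
   latter passes to finite structures. *)
- move=> [n [_ B2]]; apply: finite_connected => //.
    by apply: finite_prod => //; exact: finite_finset.
  apply/A1_B1/walk_A1/(@layers_walk _ 'I_n.+1 ord0 _ _ n) => //.
    by rewrite card_ord.
  by apply: B2; apply: finite_prod => //; exact: finite_finset.
(* The 1-link has two layers, one more than a step in [C] can alter. *)
- move=> B3 G _; apply: walk_B4.
  by apply: (@layers_walk _ bool true _ _ 1) => //; rewrite card_bool.
- move=> B4; apply: B4 => //.
  + exact: Hom_fst.
  + exact: Hom_snd.
  + by apply: sub_finite_set finHH.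
- by move=> /walkP/walk_irreducible[g irr]; exists g.
(* The forest may be uncountable, so (C1) is applied to [leveled (square H)]; the resulting (A1)
   gives back the walk, and with it a gap [g'] for the forest. *)
- move=> [g C1].
  have countT : countable_str (leveled (square H)).
    by rewrite /countable_str -setXTT; apply: countableX => //;
      exact: finite_set_countable.
  have /A1_A2[K /A2_walk/walk_irreducible[g' irr]] :=
    leveled_dismantles finH (C1 _ countT).
  by exists g' => x W; exact: irr.
- by move=> [g C2]; exact: walk_forest_dismantles C2.
Qed.
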